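(* Let $p_t$, $t\in[0,1]$, be the marginals of the forward CTMC with rates $Q_t$ started from the data distribution $p_0$, and let $p^\theta_t$ be the marginals of the learned reverse process started at time $1$ from the reference distribution $p^\theta_1=p_r$. Then $$D_{KL}(p_0\,\|\,p_0^\theta)\le \int_0^1\mathbb{E}_{x_t\sim p_t}\sum_{y\neq x_t}Q_t(x_t,y)\,\ell\!\left(\frac{p_t(y)}{p_t(x_t)},\,s_\theta(x_t,t)_y\right)dt + D_{KL}(p_1\,\|\,p_r).$$
   Context: Finite state space $\mathcal{X}$; $(Q_t)_{t\in[0,1]}$ transition-rate matrices (nonnegative off-diagonal entries, columns summing to zero, $Q_t(x,y)$ for $x\ne y$ is the rate of jumping from $y$ to $x$). The forward process has marginals $p_t$ solving $\frac{d}{dt}p_t=Q_tp_t$ from the data distribution $p_0$. The true reverse process runs from $t=1$ to $t=0$, starts from $p_1$, and jumps from $x$ to $y\neq x$ at time $t$ with rate $Q_t(x,y)\,p_t(y)/p_t(x)$; its marginals are $p_t$. A model $s_\theta(x,t)_y>0$ ($x\ne y$) approximates the ratios $p_t(y)/p_t(x)$; the learned reverse process runs from $t=1$ to $t=0$, starts from a reference distribution $p_r$, and jumps from $x$ to $y\neq x$ at rate $Q_t(x,y)\,s_\theta(x,t)_y$; its marginals are denoted $p^\theta_t$ (so $p^\theta_1=p_r$, and $p^\theta_0$ is the learned data distribution). $K(a)=a(\log a-1)$ with $K(0)=0$, $\ell(a,b)=b-a\log b+K(a)$. All quantities are assumed regular enough for the integrals to be defined. *)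

(* Defs.v *)
From HB Require Import structures.
From mathcomp Require Import all_boot all_order all_algebra.
From mathcomp Require Import all_classical all_reals all_analysis.
Set Implicit Arguments. Unset Strict Implicit. Unset Printing Implicit Defensive.
Import Order.TTheory GRing.Theory Num.Theory.
Import numFieldNormedType.Exports.
Local Open Scope ring_scope.
Local Open Scope classical_set_scope.

Definition Kfun {R : realType} (a : R) : R := if a == 0 then 0 else a * (ln a - 1).

Definition ell {R : realType} (a b : R) : R := b - a * ln b + Kfun a.

Definition KL {R : realType} {X : finType} (p q : X -> R) : R :=
  \sum_(x : X) (if p x == 0 then 0 else p x * ln (p x / q x)).

Definition is_distr {R : realType} {X : finType} (p : X -> R) : Prop :=
  (forall x, 0 <= p x) /\ \sum_(x : X) p x = 1.

(* a transition-rate matrix: Q x y (x <> y) is the rate of jumping from y to x;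
   off-diagonal entries nonnegative, columns sum to zero *)
Definition is_rate_matrix {R : realType} {X : finType} (Q : X -> X -> R) : Prop :=
  (forall x y, x != y -> 0 <= Q x y) /\ (forall y, \sum_(x : X) Q x y = 0).

Definition dse_integrand {R : realType} {X : finType}
  (Q : R -> X -> X -> R) (p : R -> X -> R) (s : X -> R -> X -> R) (t : R) : R :=
  \sum_(x : X) p t x *
     \sum_(y : X | y != x) Q t x y * ell (p t y / p t x) (s x t y).

(* Main.v *)
Require Import Defs.
From HB Require Import structures.
From mathcomp Require Import all_boot all_order all_algebra.
From mathcomp Require Import all_classical all_reals all_analysis.
From mathcomp Require Import ring lra.
Import Order.TTheory GRing.Theory Num.Theory.
Import numFieldNormedType.Exports.
Local Open Scope ring_scope.
Local Open Scope classical_set_scope.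

(* Along (0, 1), the time derivative of KL(p_t || p^theta_t) plus the score-entropy
   integrand is a sum over edges x <> y of Q_t(x,y) p_t(y) (c - 1 - ln c) with
   c = s(x,t)_y p^theta_t(x) / p^theta_t(y), hence nonnegative since ln c <= c - 1.
   So t |-> KL(p_t || p^theta_t) + int_0^t integrand is nondecreasing on [0, 1]
   (continuity at t = 0, where p_0 may vanish, comes from a ln a -> 0), and
   comparing its values at 0 and 1 gives the bound. *)

Section elementary.
Context {R : realType}.
Implicit Types a b c : R.

Lemma KfunE a : Kfun a = a * (ln a - 1).
Proof. by rewrite /Kfun; case: eqP => [->|//]; rewrite mul0r. Qed.

Lemma ln_le_subr1 {c} : 0 < c -> ln c <= c - 1.
Proof. by move=> c0; have := @le_ln1Dx R (c - 1); rewrite addrCA subrr addr0; apply; lra. Qed.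

Lemma ell_ge0 a b : 0 <= a -> 0 < b -> 0 <= ell a b.
Proof.
move=> a0 b0; rewrite /ell KfunE.
have [->|an0] := eqVneq a 0; first by rewrite !mul0r subr0 addr0 ltW.
have a_gt0 : 0 < a by rewrite lt_def an0.
have := ln_le_subr1 (divr_gt0 b0 a_gt0); rewrite ln_div ?posrE// => lnba.
have : 0 <= a * (b / a - 1 - (ln b - ln a)) by apply: mulr_ge0; [exact: ltW|lra].
suff -> : a * (b / a - 1 - (ln b - ln a)) = b - a * ln b + a * (ln a - 1) by [].
by field.
Qed.

(* From [ln (1/r) <= 1/r - 1] at [r = sqrt a]. *)
Lemma mulr_ln_ge a : 0 < a -> a <= 1 -> - (2 * Num.sqrt a) <= a * ln a.
Proof.
move=> a0 a1; set r := Num.sqrt a.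
have r0 : 0 < r by rewrite sqrtr_gt0.
have ar : a = r * r by rewrite -expr2 sqr_sqrtr// ltW.
have lnr : 1 - r^-1 <= ln r.
  have rV0 : 0 < r^-1 by rewrite invr_gt0.
  by have := ln_le_subr1 rV0; rewrite lnV ?posrE//; lra.
have : r - 1 <= r * ln r.
  by have := ler_wpM2l (ltW r0) lnr; rewrite mulrBr mulr1 mulfV ?gt_eqF.
rewrite ar lnM ?posrE//.
nra.
Qed.

Lemma mulr_ln_cvg0 : a * ln a @[a --> (0 : R)] --> (0 : R).
Proof.
have bound_cont : {for 0, continuous (fun a : R => 2 * Num.sqrt `|a|)}.
  apply: cvgMr.
  exact: (continuous_comp (@norm_continuous _ R^o 0) (@sqrt_continuous R _)).
have bound_cvg0 : 2 * Num.sqrt `|a| @[a --> (0 : R)] --> (0 : R).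
  by have := bound_cont; rewrite /prop_for /continuous_at normr0 sqrtr0 mulr0.
apply: (@squeeze_cvgr _ _ _ _ (fun a => - (2 * Num.sqrt `|a|)) (fun a => 2 * Num.sqrt `|a|)).
- near=> a.
  have a1 : `|a| < 1 by near: a; exists 1 => //= z /=; rewrite sub0r normrN.
  have [a_le0|a_gt0] := leP a 0.
    by rewrite ln0// mulr0 oppr_le0 andbC mulr_ge0 ?sqrtr_ge0.
  have a_le1 : a <= 1 by rewrite -(gtr0_norm a_gt0) ltW.
  by rewrite gtr0_norm// mulr_ln_ge//= (le_trans (mulr_ge0_le0 (ltW a_gt0) (ln_le0 a_le1))).
- by rewrite -[X in _ --> X]oppr0; apply: cvgN.
- exact: bound_cvg0.
Unshelve. all: by end_near. Qed.

Lemma continuous_mulr_ln {a} : 0 <= a -> {for a, continuous (fun u : R => u * ln u)}.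
Proof.
rewrite le_eqVlt => /predU1P[<-|a_gt0].
  by rewrite /prop_for /continuous_at mul0r; exact: mulr_ln_cvg0.
by apply: cvgM; [exact: cvg_id|exact: continuous_ln].
Qed.

End elementary.

Section limits.
Context {R : realType} {T : Type} {F : set_system T} {FF : Filter F}.
Implicit Types (f g : T -> R) (a b l : R).

Lemma cvg_ln f l : 0 < l -> f @ F --> l -> ln (f x) @[x --> F] --> ln l.
Proof. by move=> l0 fl; apply: (cvg_comp _ _ fl); exact: continuous_ln. Qed.

Lemma cvg_mul_ln_div f g a b : 0 <= a -> 0 < b -> (\forall x \near F, 0 <= f x) ->
  f @ F --> a -> g @ F --> b ->
  f x * ln (f x / g x) @[x --> F] --> a * ln (a / b).
Proof.
move=> a0 b0 f0 fa gb.
have g0 := cvgr_gt b gb 0 b0.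
have mul_ln_divE (u v : R) : 0 <= u -> 0 < v -> u * ln (u / v) = u * ln u - u * ln v.
  rewrite le_eqVlt => /predU1P[<-|u0] v0; first by rewrite !mul0r subrr.
  by rewrite ln_div ?posrE// mulrBr.
have split_near : {near F, (fun x => f x * ln (f x) - f x * ln (g x)) =1
    (fun x => f x * ln (f x / g x))}.
  by near=> x; rewrite /= mul_ln_divE//; [near: x; exact: f0|near: x; exact: g0].
apply: cvg_trans (near_eq_cvg split_near) _.
rewrite mul_ln_divE//; apply: cvgB; last by apply: cvgM => //; exact: cvg_ln.
by have := cvg_comp _ _ fa (continuous_mulr_ln a0); exact.
Unshelve. all: by end_near. Qed.

Lemma cvg_ell f g a b : 0 < a -> 0 < b -> f @ F --> a -> g @ F --> b ->
  ell (f x) (g x) @[x --> F] --> ell a b.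
Proof.
move=> a0 b0 fa gb; rewrite /ell KfunE; under eq_cvg do rewrite KfunE.
apply: cvgD; first by apply: cvgB => //; apply: cvgM => //; exact: cvg_ln.
by apply: cvgM => //; apply: cvgB; [exact: cvg_ln|exact: cvg_cst].
Qed.

End limits.

Lemma is_derive_mul_ln_div (R : realType) (f g : R -> R) (t df dg : R) :
  0 < f t -> 0 < g t -> is_derive t 1 f df -> is_derive t 1 g dg ->
  is_derive t 1 (fun u => f u * ln (f u / g u))
    (df * (ln (f t / g t) + 1) - f t / g t * dg).
Proof.
move=> f0 g0 fd gd.
have gVd : is_derive t 1 (fun u => (g u)^-1) (- (g t) ^- 2 *: dg).
  by apply: is_deriveV => //; rewrite gt_eqF.
have fgVd : is_derive t 1 (f * (fun u => (g u)^-1))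
    (f t *: (- (g t) ^- 2 *: dg) + (g t)^-1 *: df) by exact: is_deriveM.
have lnd : is_derive t 1 ((@ln R) \o (f * (fun u => (g u)^-1)))
    ((f t / g t)^-1 * (f t *: (- (g t) ^- 2 *: dg) + (g t)^-1 *: df)).
  by apply: is_derive1_comp => //; apply: is_derive1_ln; rewrite divr_gt0.
rewrite (_ : (fun u => _) = f * ((@ln R) \o (f * (fun u => (g u)^-1)))); last exact/funext.
apply: is_derive_eq (is_deriveM fd lnd) _.
by rewrite /= /GRing.scale /=; field; rewrite !gt_eqF.
Qed.

Lemma is_derive_sum_seq (R : realType) (I : Type) (r : seq I) (h : I -> R -> R)
    (dh : I -> R) (t : R) :
  (forall i, is_derive t 1 (h i) (dh i)) ->
  is_derive t 1 (fun u => \sum_(i <- r) h i u) (\sum_(i <- r) dh i).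
Proof.
move=> hd; elim: r => [|i r IHr].
  rewrite big_nil (_ : (fun _ => _) = cst 0); first exact: is_derive_cst.
  by apply/funext => u; rewrite big_nil.
rewrite big_cons (_ : (fun _ => _) = h i + (fun u => \sum_(j <- r) h j u)).
  exact: is_deriveD.
by apply/funext => u; rewrite big_cons.
Qed.

Section offdiagonal_sums.
Context {R : comRingType} {X : finType}.

Lemma sum_offdiag_swap (g : X -> X -> R) :
  \sum_x \sum_(y | y != x) g x y = \sum_x \sum_(y | y != x) g y x.
Proof.
under eq_bigr do rewrite big_mkcond.
rewrite exchange_big /=; apply: eq_bigr => y _; rewrite [RHS]big_mkcond.
by apply: eq_bigr => x _; rewrite eq_sym.
Qed.

Lemma sum_flux_weighted (J : X -> X -> R) (g : X -> R) :
  \sum_x g x * \sum_(y | y != x) (J x y - J y x) =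
  \sum_x \sum_(y | y != x) J x y * (g x - g y).
Proof.
transitivity (\sum_x \sum_(y | y != x) J x y * g x - \sum_x \sum_(y | y != x) J y x * g x).
  rewrite -sumrB; apply: eq_bigr => x _.
  by rewrite -sumrB mulr_sumr; apply: eq_bigr => y _; ring.
rewrite [X in _ - X]sum_offdiag_swap -sumrB; apply: eq_bigr => x _.
by rewrite -sumrB; apply: eq_bigr => y _; ring.
Qed.

Lemma rate_mulvE (Q : X -> X -> R) (P : X -> R) x :
  (forall y, \sum_z Q z y = 0) ->
  \sum_y Q x y * P y = \sum_(y | y != x) (Q x y * P y - Q y x * P x).
Proof.
move=> colsum0; rewrite (bigD1 x)//= addrC sumrB -big_distrl /=; congr (_ + _).
have := colsum0 x; rewrite (bigD1 x)//= => /eqP; rewrite addr_eq0 => /eqP ->.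
by rewrite mulNr.
Qed.

End offdiagonal_sums.

(* The contribution of the edge x -> y, with [a, b, u, v, s] = [P x, P y, q x, q y, S x y]. *)
Lemma flux_ellE (R : realType) (a b u v s : R) :
  0 < a -> 0 < b -> 0 < u -> 0 < v -> 0 < s ->
  b * (ln (a / u) - ln (b / v)) - s * u * (a / u - b / v) + a * ell (b / a) s =
  b * (s * u / v - 1 - ln (s * u / v)).
Proof.
move=> a0 b0 u0 v0 s0; rewrite /ell KfunE !ln_div ?lnM ?posrE ?mulr_gt0//.
by field; rewrite !gt_eqF.
Qed.

Section kl_dissipation.
Context {R : realType} {X : finType}.

Definition kl_deriv (P dP q dq : X -> R) : R :=
  \sum_x (dP x * (ln (P x / q x) + 1) - P x / q x * dq x).

Definition forward_drift (Q : X -> X -> R) (P : X -> R) (x : X) : R :=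
  \sum_y Q x y * P y.

(* Kolmogorov equation of the chain jumping x -> y at rate [Q x y * S x y],
   run backwards in time. *)
Definition reverse_drift (Q S : X -> X -> R) (q : X -> R) (x : X) : R :=
  - \sum_(y | y != x) (Q y x * S y x * q y - Q x y * S x y * q x).

Variables (Q S : X -> X -> R) (P q : X -> R).
Hypothesis Q_rate : is_rate_matrix Q.
Hypotheses (P_gt0 : forall x, 0 < P x) (q_gt0 : forall x, 0 < q x).
Hypothesis S_gt0 : forall x y, x != y -> 0 < S x y.

Lemma kl_deriv_add_dse_ge0 :
  0 <= kl_deriv P (forward_drift Q P) q (reverse_drift Q S q)
       + \sum_x P x * \sum_(y | y != x) Q x y * ell (P y / P x) (S x y).
Proof.
have [Q_ge0 colsum0] := Q_rate.
pose L x := ln (P x / q x) + 1.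
have fwdE : \sum_x forward_drift Q P x * L x =
    \sum_x \sum_(y | y != x) Q x y * P y * (L x - L y).
  rewrite -sum_flux_weighted; apply: eq_bigr => x _.
  by rewrite /forward_drift rate_mulvE// mulrC.
have revE : \sum_x P x / q x * reverse_drift Q S q x =
    \sum_x \sum_(y | y != x) Q x y * S x y * q x * (P x / q x - P y / q y).
  rewrite -sum_flux_weighted; apply: eq_bigr => x _.
  by rewrite /reverse_drift -sumrN; congr (_ * _); apply: eq_bigr => y _; rewrite opprB.
rewrite /kl_deriv sumrB fwdE revE -sumrB -big_split /=.
apply: sumr_ge0 => x _; rewrite mulr_sumr -sumrB -big_split /=.
apply: sumr_ge0 => y yx; have xy : x != y by rewrite eq_sym.
have c_gt0 : 0 < S x y * q x / q y by rewrite !mulr_gt0 ?invr_gt0 ?S_gt0.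
have -> : Q x y * P y * (L x - L y) - Q x y * S x y * q x * (P x / q x - P y / q y)
    + P x * (Q x y * ell (P y / P x) (S x y)) =
    Q x y * (P y * (ln (P x / q x) - ln (P y / q y)) - S x y * q x * (P x / q x - P y / q y)
      + P x * ell (P y / P x) (S x y)) by rewrite /L; ring.
rewrite flux_ellE ?S_gt0//; apply: mulr_ge0; first exact: Q_ge0.
by apply: mulr_ge0; [exact: ltW|have := ln_le_subr1 c_gt0; lra].
Qed.

End kl_dissipation.

Lemma le_add_integral_of_derive (R : realType) (F dF f : R -> R) (a b : R) : a < b ->
  {within `[a, b], continuous F} ->
  (forall t, t \in `]a, b[ -> is_derive t 1 F (dF t)) ->
  (forall t, t \in `]a, b[ -> {for t, continuous f}) ->
  lebesgue_measure.-integrable `[a, b] (EFin \o f) ->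
  (forall t, t \in `]a, b[ -> 0 <= dF t + f t) ->
  F a <= F b + \int[lebesgue_measure]_(t in `[a, b]) f t.
Proof.
move=> ab F_cont F_der f_cont f_int dFf_ge0.
pose H := F + (fun x => parameterized_integral lebesgue_measure a x f).
have H_cont : {within `[a, b], continuous H}.
  exact: within_continuousD (parameterized_integral_continuous (ltW ab) f_int).
have H_der t : t \in `]a, b[%R -> derivable H t 1 /\ 0 <= H^`() t.
  move=> tab; have tab' : t \in `]a, b[ by rewrite inE.
  move: (tab); rewrite in_itv /= => /andP[a_lt_t t_lt_b].
  have [dI I'] := continuous_FTC1_closed t_lt_b f_int a_lt_t (f_cont t tab').
  have [dF' F'] := F_der t tab'.
  by split; [exact: derivableD|rewrite derive1E deriveD// F' -derive1E I'; exact: dFf_ge0].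
have := ger0_derive1_ndecr (fun t tab => (H_der t tab).1) (fun t tab => (H_der t tab).2)
  H_cont (lexx a) (ltW ab) (lexx b).
by rewrite /H /= /parameterized_integral !fctE set_itv1 Rintegral_set1 addr0.
Qed.

Lemma KL_mul_ln (R : realType) (X : finType) (P q : X -> R) :
  KL P q = \sum_x P x * ln (P x / q x).
Proof. by apply: eq_bigr => x _; case: eqP => // ->; rewrite mul0r. Qed.

Section learned_reverse_process.
Context {R : realType} {X : finType}.
Context {Q : R -> X -> X -> R} {p : R -> X -> R} {s : X -> R -> X -> R}
  {ptheta : R -> X -> R}.

Hypothesis Q_rate : forall t : R, t \in `[0, 1] -> is_rate_matrix (Q t).
Hypothesis Q_cont : forall x y, {within `[0, 1], continuous (fun t => Q t x y)}.
Hypothesis s_gt0 : forall (x y : X) (t : R), x != y -> 0 < s x t y.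
Hypothesis s_cont : forall x y, {within `[0, 1], continuous (fun t => s x t y)}.
Hypothesis p0_distr : is_distr (p 0).
Hypothesis p_cont : forall x, {within `[0, 1], continuous (fun t => p t x)}.
Hypothesis p_der : forall (t : R) (x : X), t \in `]0, 1[ ->
  is_derive t 1 (fun u => p u x) (forward_drift (Q t) (p t) x).
Hypothesis p_gt0 : forall (t : R) (x : X), t \in `]0, 1] -> 0 < p t x.
Hypothesis ptheta_cont : forall x, {within `[0, 1], continuous (fun t => ptheta t x)}.
Hypothesis ptheta_der : forall (t : R) (x : X), t \in `]0, 1[ ->
  is_derive t 1 (fun u => ptheta u x) (reverse_drift (Q t) (fun x y => s x t y) (ptheta t) x).
Hypothesis ptheta_gt0 : forall (t : R) (x : X), t \in `[0, 1] -> 0 < ptheta t x.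

Lemma mem_itv01_oo_cc {t : R} : t \in `]0, 1[ -> t \in `[0, 1].
Proof. by rewrite !inE /= !in_itv /= => /andP[t0 t1]; rewrite !ltW. Qed.

Lemma mem_itv01_oo_oc {t : R} : t \in `]0, 1[ -> t \in `]0, 1].
Proof. by rewrite !inE /= !in_itv /= => /andP[-> t1]; rewrite ltW. Qed.

Lemma p_ge0 (t : R) (x : X) : t \in `[0, 1] -> 0 <= p t x.
Proof.
have [->|t_neq0] := eqVneq t 0; first by move=> _; exact: p0_distr.1.
rewrite !inE /= in_itv /= => /andP[t_ge0 t_le1].
by apply/ltW/p_gt0; rewrite inE /= in_itv /= t_le1 andbT lt_def t_neq0.
Qed.

Lemma dse_integrand_ge0 (t : R) : t \in `[0, 1] -> 0 <= dse_integrand Q p s t.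
Proof.
move=> t01; apply: sumr_ge0 => x _.
have [->|px_neq0] := eqVneq (p t x) 0; first by rewrite mul0r.
have px_gt0 : 0 < p t x by rewrite lt_def px_neq0 p_ge0.
apply: mulr_ge0; first exact: ltW.
apply: sumr_ge0 => y yx; have xy : x != y by rewrite eq_sym.
apply: mulr_ge0; first exact: (Q_rate t t01).1.
by apply: ell_ge0; [rewrite divr_ge0 ?p_ge0 ?ltW|exact: s_gt0].
Qed.

Lemma continuous_at_of_within (f : R -> R) (t : R) : t \in `]0, 1[ ->
  {within `[0, 1], continuous f} -> {for t, continuous f}.
Proof.
by move=> t01 f_cont; apply: (within_continuous_continuous ltr01 f_cont); rewrite inE in t01.
Qed.

Lemma continuous_dse_integrand (t : R) : t \in `]0, 1[ ->
  {for t, continuous (dse_integrand Q p s)}.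
Proof.
move=> t01; have pt_gt0 x : 0 < p t x by exact: p_gt0 _ _ (mem_itv01_oo_oc t01).
rewrite /prop_for /continuous_at /dse_integrand.
apply: cvg_big => // [|x _]; first exact: add_continuous.
apply: cvgM; first exact: continuous_at_of_within.
apply: cvg_big => // [|y yx]; first exact: add_continuous.
apply: cvgM; first exact: continuous_at_of_within.
apply: cvg_ell; [by rewrite divr_gt0|by apply: s_gt0; rewrite eq_sym| |].
- apply: cvgM; first exact: continuous_at_of_within.
  by apply: cvgV; [rewrite gt_eqF|exact: continuous_at_of_within].
- exact: continuous_at_of_within.
Qed.

Lemma continuous_KL_marginals :
  {within `[0, 1], continuous (fun t => KL (p t) (ptheta t))}.
Proof.
rewrite (_ : (fun t => _) = fun t => \sum_x p t x * ln (p t x / ptheta t x)).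
  2: by apply/funext => t; rewrite KL_mul_ln.
apply/subspace_continuousP => t t01.
apply: cvg_big => // [|x _]; first exact: add_continuous.
apply: cvg_mul_ln_div.
- exact: p_ge0 (mem_set t01).
- exact: ptheta_gt0 (mem_set t01).
- by apply: filterS (withinT _ _) => u u01; exact: p_ge0 (mem_set u01).
- exact: (subspace_continuousP _ _).1 (p_cont x) t t01.
- exact: (subspace_continuousP _ _).1 (ptheta_cont x) t t01.
Qed.

Lemma is_derive_KL_marginals (t : R) : t \in `]0, 1[ ->
  is_derive t 1 (fun u => KL (p u) (ptheta u))
    (kl_deriv (p t) (forward_drift (Q t) (p t)) (ptheta t)
       (reverse_drift (Q t) (fun x y => s x t y) (ptheta t))).
Proof.
move=> t01; rewrite (_ : (fun u => _) = fun u => \sum_x p u x * ln (p u x / ptheta u x)).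
  2: by apply/funext => u; rewrite KL_mul_ln.
apply: is_derive_sum_seq => x; apply: is_derive_mul_ln_div.
- exact: p_gt0 _ _ (mem_itv01_oo_oc t01).
- exact: ptheta_gt0 _ _ (mem_itv01_oo_cc t01).
- exact: p_der.
- exact: ptheta_der.
Qed.

Lemma integrable_dse_integrand :
  (\int[lebesgue_measure]_(t in `[0%R, 1%R]) (dse_integrand Q p s t)%:E < +oo)%E ->
  lebesgue_measure.-integrable `[0, 1] (EFin \o dse_integrand Q p s).
Proof.
move=> int_fin; apply/integrableP; split.
  apply/measurable_realfun.measurable_EFinP.
  apply: (@measurable_realfun.measurable_fun_itv_cc _ 0 1 false true).
  apply: measurable_realfun.open_continuous_measurable_fun; first exact: interval_open.
  by move=> t t01; exact: continuous_dse_integrand.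
by under eq_integral => t t01 do rewrite /= ger0_norm ?dse_integrand_ge0//.
Qed.

Lemma KL_marginals_dissipation (t : R) : t \in `]0, 1[ ->
  0 <= kl_deriv (p t) (forward_drift (Q t) (p t)) (ptheta t)
         (reverse_drift (Q t) (fun x y => s x t y) (ptheta t))
       + dse_integrand Q p s t.
Proof.
move=> t01; apply: kl_deriv_add_dse_ge0 => [|x|x|x y].
- exact: Q_rate (mem_itv01_oo_cc t01).
- exact: p_gt0 (mem_itv01_oo_oc t01).
- exact: ptheta_gt0 (mem_itv01_oo_cc t01).
- exact: s_gt0.
Qed.

End learned_reverse_process.

Theorem theorem1 (R : realType) (X : finType)
  (Q : R -> X -> X -> R) (p : R -> X -> R) (s : X -> R -> X -> R)
  (ptheta : R -> X -> R) (pr : X -> R) :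
  (forall t : R, t \in `[0%R, 1%R] -> is_rate_matrix (Q t)) ->
  (forall x y, {within `[0%R, 1%R], continuous (fun t => Q t x y)}) ->
  (forall (x y : X) (t : R), x != y -> 0 < s x t y) ->
  (forall x y, {within `[0%R, 1%R], continuous (fun t => s x t y)}) ->
  is_distr (p 0) ->
  (forall x, {within `[0%R, 1%R], continuous (fun t => p t x)}) ->
  (forall (t : R) (x : X), t \in `]0%R, 1%R[ ->
     is_derive t 1 (fun u => p u x) (\sum_(y : X) Q t x y * p t y)) ->
  (forall (t : R) (x : X), t \in `]0%R, 1%R] -> 0 < p t x) ->
  is_distr pr -> (forall x, 0 < pr x) ->
  ptheta 1 = pr ->
  (forall x, {within `[0%R, 1%R], continuous (fun t => ptheta t x)}) ->
  (forall (t : R) (x : X), t \in `]0%R, 1%R[ ->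
     is_derive t 1 (fun u => ptheta u x)
       (- \sum_(y : X | y != x)
            (Q t y x * s y t x * ptheta t y - Q t x y * s x t y * ptheta t x))) ->
  (forall (t : R) (x : X), t \in `[0%R, 1%R] -> 0 < ptheta t x) ->
  ((KL (p 0) (ptheta 0))%:E <=
     (\int[lebesgue_measure]_(t in `[0%R, 1%R]) (dse_integrand Q p s t)%:E)
     + (KL (p 1) pr)%:E)%E.
Proof.
move=> Q_rate Q_cont s_gt0 s_cont p0_distr p_cont p_der p_gt0 _ _ ptheta1
  ptheta_cont ptheta_der ptheta_gt0.
set I := (\int[lebesgue_measure]_(t in _) _)%E.
have I_ge0 : (0 <= I)%E.
  apply: integral_ge0 => t t01; rewrite lee_fin.
  by apply: dse_integrand_ge0 => //; exact: mem_set.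
have [->|I_neq_oo] := eqVneq I +oo%E; first by rewrite addye ?leey.
have I_lt_oo : (I < +oo)%E by rewrite ltey.
have I_fin : I \is a fin_num by rewrite ge0_fin_numE.
rewrite -ptheta1 -(fineK I_fin) -EFinD lee_fin addrC.
apply: (@le_add_integral_of_derive R (fun t => KL (p t) (ptheta t)) _ (dse_integrand Q p s)
  0 1 ltr01).
- by apply: continuous_KL_marginals.
- by move=> t t01; apply: is_derive_KL_marginals.
- by move=> t t01; apply: continuous_dse_integrand.
- by apply: integrable_dse_integrand.
- by move=> t t01; apply: KL_marginals_dissipation.
Qed.
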